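(* Let $0<\delta\le \mu_g/(2l_{f,1})$. Suppose that: (i) for every $x\in\mathbb{R}^{d_x}$ the set $\mathcal{Y}(x)$ is nonempty, closed and convex, and $\inf_{x}\Phi(x)>-\infty$; (ii) $f,\nabla f,\nabla g$ are Lipschitz continuous with constants $l_{f,0},l_{f,1},l_{g,1}$ respectively, jointly over $\{(x,y): x\in\mathbb{R}^{d_x},\,y\in\mathcal{Y}(x)\}$; (iii) for every fixed $x$, $g(x,\cdot)$ is $\mu_g$-strongly convex on $\mathcal{Y}(x)$, with $\mu_g>0$. Then for every $x\in\mathbb{R}^{d_x}$, $$0\le \Phi(x)-\Phi_\delta(x)\le \frac{\delta\, l_{f,0}^2}{2\mu_g},\qquad \|y^*_\delta(x)-y^*(x)\|\le \frac{2\delta\, l_{f,0}}{\mu_g}.$$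
   Context: Let $f,g:\mathbb{R}^{d_x}\times\mathbb{R}^{d_y}\to\mathbb{R}$ be continuously differentiable, $h:\mathbb{R}^{d_x}\times\mathbb{R}^{d_y}\to\mathbb{R}^{d_h}$, and $\mathcal{Y}(x)=\{y\in\mathbb{R}^{d_y}: h(x,y)\le 0\}$ (componentwise inequality). Define $y^*(x)=\arg\min_{y\in\mathcal{Y}(x)}g(x,y)$, the bilevel hyper-objective $\Phi(x)=f(x,y^*(x))$, and for $\delta>0$ $$y^*_\delta(x)=\arg\min_{y\in\mathcal{Y}(x)}\{\delta f(x,y)+g(x,y)\},$$ $$\Phi_\delta(x)=\min_{y\in\mathcal{Y}(x)}\max_{z\in\mathcal{Y}(x)}\Big\{f(x,y)+\tfrac1\delta\big[g(x,y)-g(x,z)\big]\Big\}.$$ Here $\|\cdot\|$ is the Euclidean norm. *)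

(* Defs.v *)
From HB Require Import structures.
From mathcomp Require Import all_boot all_order all_algebra.
From mathcomp Require Import all_classical all_reals all_analysis.
Set Implicit Arguments.
Unset Strict Implicit.
Unset Printing Implicit Defensive.
Import Order.TTheory GRing.Theory Num.Theory.
Import numFieldNormedType.Exports.
Local Open Scope classical_set_scope.
Local Open Scope ring_scope.

(* The library norm `|_| on 'rV[R]_n and on products is the sup norm, hence the
   explicit Euclidean norms below; the topologies agree, so the library notions
   closed, continuous and differentiable can be used unchanged. *)
Definition enorm (R : realType) (n : nat) (v : 'rV[R]_n) : R :=
  Num.sqrt (\sum_(i < n) v 0 i ^+ 2).

Definition enorm2 (R : realType) (m n : nat) (p : 'rV[R]_m * 'rV[R]_n) : R :=
  Num.sqrt (\sum_(i < m) p.1 0 i ^+ 2 + \sum_(j < n) p.2 0 j ^+ 2).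

Definition grad (R : realType) (m n : nat) (F : 'rV[R]_m * 'rV[R]_n -> R)
    (p : 'rV[R]_m * 'rV[R]_n) : 'rV[R]_m * 'rV[R]_n :=
  (\row_(i < m) 'D_(delta_mx 0 i, 0) F p, \row_(j < n) 'D_(0, delta_mx 0 j) F p).

Definition C1 (R : realType) (m n : nat) (F : 'rV[R]_m * 'rV[R]_n -> R) : Prop :=
  (forall p, differentiable F p) /\ continuous (grad F).

(* A Lipschitz constant is nonnegative by convention; without 0 <= k, a negative
   k would be accepted on a one-point domain. *)
Definition lipschitz_with (R : realType) (m n : nat) (W : zmodType)
    (normW : W -> R) (k : R) (D : set ('rV[R]_m * 'rV[R]_n))
    (F : 'rV[R]_m * 'rV[R]_n -> W) : Prop :=
  0 <= k /\
  forall p q, D p -> D q -> normW (F p - F q) <= k * enorm2 (p - q).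

Definition strongly_convex (R : realType) (n : nat) (mu : R)
    (D : set 'rV[R]_n) (F : 'rV[R]_n -> R) : Prop :=
  forall (t : R) (y z : 'rV[R]_n), 0 <= t <= 1 -> D y -> D z ->
    F (t *: y + (1 - t) *: z)
      <= t * F y + (1 - t) * F z - mu / 2 * t * (1 - t) * enorm (y - z) ^+ 2.

(* A chosen minimizer (maximizer) of F over D, and 0 if there is none; so min_on
   and max_on are meaningful only when the optimum is attained. *)
Definition argmin (R : realType) (n : nat)
    (D : set 'rV[R]_n) (F : 'rV[R]_n -> R) : 'rV[R]_n :=
  xget 0 [set y | D y /\ forall z, D z -> F y <= F z].

Definition argmax (R : realType) (n : nat)
    (D : set 'rV[R]_n) (F : 'rV[R]_n -> R) : 'rV[R]_n :=
  xget 0 [set y | D y /\ forall z, D z -> F z <= F y].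

Definition min_on (R : realType) (n : nat)
    (D : set 'rV[R]_n) (F : 'rV[R]_n -> R) : R := F (argmin D F).

Definition max_on (R : realType) (n : nat)
    (D : set 'rV[R]_n) (F : 'rV[R]_n -> R) : R := F (argmax D F).

Section bilevel.
Context (R : realType) (dx dy dh : nat).
Variables (f g : 'rV[R]_dx * 'rV[R]_dy -> R)
          (h : 'rV[R]_dx * 'rV[R]_dy -> 'rV[R]_dh).

Definition feasible (x : 'rV[R]_dx) : set 'rV[R]_dy :=
  [set y | forall i, h (x, y) 0 i <= 0].

Definition feasible_graph : set ('rV[R]_dx * 'rV[R]_dy) :=
  [set p | feasible p.1 p.2].

Definition ystar (x : 'rV[R]_dx) : 'rV[R]_dy :=
  argmin (feasible x) (fun y => g (x, y)).

Definition Phi (x : 'rV[R]_dx) : R := f (x, ystar x).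

Definition ystar_pen (delta : R) (x : 'rV[R]_dx) : 'rV[R]_dy :=
  argmin (feasible x) (fun y => delta * f (x, y) + g (x, y)).

Definition Phi_pen (delta : R) (x : 'rV[R]_dx) : R :=
  min_on (feasible x) (fun y =>
    max_on (feasible x) (fun z =>
      f (x, y) + delta^-1 * (g (x, y) - g (x, z)))).

End bilevel.

(* Main.v *)
Require Import Defs.
From HB Require Import structures.
From mathcomp Require Import all_boot all_order all_algebra.
From mathcomp Require Import all_classical all_reals all_analysis.
From mathcomp Require Import ring lra.
Import Order.TTheory GRing.Theory Num.Theory.
Import numFieldNormedType.Exports.
Local Open Scope classical_set_scope.
Local Open Scope ring_scope.
Set Implicit Arguments.
Unset Strict Implicit.

(** Fix x, and write Y for the feasible set, F and G for the slices of f and g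
at x, P for delta F + G, a for the minimizer of G on Y and b for that of P.

A function whose gradient is L-Lipschitz fails convexity by at most
L/2 t (1 - t) |y - z|^2 along a segment, because adding L/2 s^2 |y - z|^2 to it
makes its derivative along the segment nondecreasing
([grad_lipschitz_weakly_convex]). Hence P is strongly convex on Y with modulus
mu_g - delta lf1, which the bound on delta makes at least mu_g / 2. A continuous
strongly convex function on a nonempty closed convex set has a minimizer
([strongly_convex_min_exists]), and grows quadratically away from it
([strongly_convex_growth]); so a and b exist.

In the penalty function, the maximum over z replaces g (x, z) by its minimum
G a, so that the penalty value is (P b - G a) / delta, and
Phi - Phi_delta = (P a - P b) / delta, which is nonnegative since b minimizes P.
With r = |b - a|, the growth of G at a and the Lipschitz bound on F give
P a - P b <= delta lf0 r - mu_g / 2 r^2, whose maximum over r is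
(delta lf0)^2 / (2 mu_g): this is the upper bound on the gap. The growth of P
at b bounds the same quantity below by mu_g / 4 r^2, so that
3/4 mu_g r <= delta lf0, slightly better than the distance bound. *)

(** * Euclidean norms *)

(** With B = |b|^2 and C the scalar product of a and b, the nonnegative sum of the
(B a_i - C b_i)^2 equals B (|a|^2 |b|^2 - C^2). *)
Lemma sum_cauchy_schwarz (R : realType) (n : nat) (a b : 'rV[R]_n) :
  \sum_(j < n) a 0 j * b 0 j <= enorm a * enorm b.
Proof.
set A := \sum_(i < n) a 0 i ^+ 2; set B := \sum_(i < n) b 0 i ^+ 2.
set C := leLHS.
have A0 : 0 <= A by apply: sumr_ge0 => i _; exact: sqr_ge0.
have B0 : 0 <= B by apply: sumr_ge0 => i _; exact: sqr_ge0.
have [B_eq0|B_neq0] := eqVneq B 0.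
  have b0 i : b 0 i = 0.
    apply/eqP; rewrite -sqrf_eq0; apply/eqP.
    apply: (psumr_eq0P (P := xpredT) (F := fun i => b 0 i ^+ 2)) => // j _.
    exact: sqr_ge0.
  rewrite /C big1 ?mulr_ge0 ?sqrtr_ge0// => i _.
  by rewrite b0 mulr0.
have Bgt0 : 0 < B by rewrite lt_def B_neq0.
have : 0 <= \sum_(i < n) (B * a 0 i - C * b 0 i) ^+ 2.
  by apply: sumr_ge0 => i _; exact: sqr_ge0.
have -> : \sum_(i < n) (B * a 0 i - C * b 0 i) ^+ 2 = B * (A * B - C ^+ 2).
  transitivity (B ^+ 2 * A - 2 * B * C * C + C ^+ 2 * B); last by ring.
  rewrite [X in - X](_ : _ = \sum_(i < n) 2 * B * C * (a 0 i * b 0 i));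
    last by rewrite -mulr_sumr.
  rewrite [X in _ + X]mulr_sumr [B ^+ 2 * A]mulr_sumr -sumrB -big_split /=.
  by apply: eq_bigr => i _; ring.
rewrite pmulr_rge0// subr_ge0 => CAB.
rewrite (le_trans (ler_norm C))// -sqrtr_sqr /enorm -sqrtrM//.
exact: ler_wsqrtr.
Qed.

Section euclidean_norm.
Context (R : realType) (m n : nat).
Implicit Types v : 'rV[R]_n.

Lemma enorm_ge0 v : 0 <= enorm v.
Proof. exact: sqrtr_ge0. Qed.

Lemma enormZ (k : R) v : enorm (k *: v) = `|k| * enorm v.
Proof.
rewrite /enorm -(sqrtr_sqr k) -sqrtrM ?sqr_ge0// mulr_sumr.
by congr Num.sqrt; apply: eq_bigr => i _; rewrite mxE exprMn.
Qed.

Lemma enormN v : enorm (- v) = enorm v.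
Proof. by rewrite -scaleN1r enormZ normrN1 mul1r. Qed.

Lemma enorm2_0l v : enorm2 ((0, v) : 'rV[R]_m * 'rV[R]_n) = enorm v.
Proof.
rewrite /enorm2 /= big1 ?add0r// => i _.
by rewrite mxE expr0n.
Qed.

Lemma enorm_snd_le (p : 'rV[R]_m * 'rV[R]_n) : enorm p.2 <= enorm2 p.
Proof.
apply: ler_wsqrtr; rewrite lerDr.
by apply: sumr_ge0 => i _; exact: sqr_ge0.
Qed.

Lemma mx_norm_le_enorm v : `|v| <= enorm v.
Proof.
have [->|/mx_norm_neq0[ij vE]] := eqVneq `|v| 0; first exact: enorm_ge0.
rewrite [leLHS]vE -sqrtr_sqr; apply: ler_wsqrtr.
rewrite (ord1 ij.1) (bigD1 ij.2)//= lerDl.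
by apply: sumr_ge0 => i _; exact: sqr_ge0.
Qed.

End euclidean_norm.

(** * Smooth functions are weakly convex *)

(** The derivative of the restriction is the differential of F at (0, d), and
(0, d) expands on the unit vectors of the second block. *)
Lemma is_derive_line (R : realType) (m n : nat)
    (F : 'rV[R]_m * 'rV[R]_n -> R) (x : 'rV[R]_m) (z d : 'rV[R]_n) (s : R) :
  differentiable F (x, z + s *: d) ->
  is_derive s 1 (fun r : R => F (x, z + r *: d))
    (\sum_(j < n) (grad F (x, z + s *: d)).2 0 j * d 0 j).
Proof.
move=> dF; set p := (x, z + s *: d).
(* Along the line, the difference quotients of the restriction are those of F
   in the direction (0, d). *)
have quotE : (fun h : R => h^-1 *: (((fun r : R => F (x, z + r *: d)) \o
      shift s) (h *: 1) - F p)) =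
    (fun h : R => h^-1 *: ((F \o shift p) (h *: (0, d)) - F p)).
  apply/funext => h /=; congr (_ *: (F _ - _)).
  rewrite /p /shift /=; apply/pair_equal_spec; split=> /=.
    by rewrite scaler0 add0r.
  by rewrite scalerDl [h *: 1]mulr1 addrCA.
split.
  rewrite /derivable; have := @diff_derivable _ _ _ F p (0, d) dF.
  by rewrite /derivable -quotE.
transitivity ('D_(0, d) F p).
  by rewrite /derive quotE.
rewrite (deriveE _ dF).
have -> : (0, d) = \sum_(j < n) d 0 j *: ((0, delta_mx 0 j)
    : 'rV[R]_m * 'rV[R]_n).
  rewrite [RHS]surjective_pairing; congr pair.
    rewrite (big_morph fst (id1 := 0) (op1 := +%R))//= big1// => i _.
    by rewrite scaler0.
  rewrite (big_morph snd (id1 := 0) (op1 := +%R))//=.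
  exact: row_sum_delta.
rewrite linear_sum; apply: eq_bigr => j _.
by rewrite linearZ /= -(deriveE _ dF) /grad /= mxE mulrC.
Qed.

(** The function phi + K/2 s^2 has a nondecreasing derivative on [0, 1], so it
lies below its chord: compare its mean slopes on [0, t] and [t, 1]. The term
K/2 s^2 itself lies below its chord by K/2 t (1 - t). *)
Lemma weakly_convex_segment (R : realType) (K : R) (phi dphi : R -> R) :
  (forall s : R, is_derive s (1 : R) phi (dphi s)) ->
  (forall a b : R, 0 <= a -> a <= b -> b <= 1 -> dphi a - dphi b <= K * (b - a)) ->
  forall t : R, 0 <= t <= 1 ->
    phi t <= t * phi 1 + (1 - t) * phi 0 + K / 2 * t * (1 - t).
Proof.
move=> phiE dphiK t /andP[t0 t1].
pose psi : R -> R := phi + (K / 2) \*: (id ^+ 2 : R -> R).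
have psiE (s : R) : is_derive s (1 : R) psi (dphi s + K * s).
  have phis := phiE s.
  by apply: is_derive_eq; rewrite /GRing.scale /=; field.
have psiV s : psi s = phi s + K / 2 * s ^+ 2 by [].
have psi_cont a b : {within `[a, b], continuous psi}.
  apply: continuous_subspaceT => s; apply: differentiable_continuous.
  by apply/derivable1_diffP; case: (psiE s).
have [b + Eb] := MVT_segment t1 (fun s _ => psiE s) (psi_cont t 1).
have [a + Ea] := MVT_segment t0 (fun s _ => psiE s) (psi_cont 0 t).
rewrite !in_itv /= => /andP[a0 at_] /andP[tb b1].
have := dphiK a b a0 (le_trans at_ tb) b1.
move: Ea Eb; rewrite !psiV.
set u := dphi a; set v := dphi b => Ea Eb uv.
have : 0 <= t * (1 - t) * ((v + K * b) - (u + K * a)).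
  by rewrite !mulr_ge0 ?subr_ge0//; lra.
nra.
Qed.

Section grad_lipschitz.
Context (R : realType) (m n : nat).
Variables (F : 'rV[R]_m * 'rV[R]_n -> R) (L : R).
Variables (D : set ('rV[R]_m * 'rV[R]_n)) (x : 'rV[R]_m).

Lemma grad_lipschitz_weakly_convex (t : R) (y z : 'rV[R]_n) :
  (forall p, differentiable F p) ->
  lipschitz_with (@enorm2 R m n) L D (grad F) ->
  (forall s : R, 0 <= s <= 1 -> D (x, s *: y + (1 - s) *: z)) ->
  0 <= t <= 1 ->
  F (x, t *: y + (1 - t) *: z) <= t * F (x, y) + (1 - t) * F (x, z)
    + L / 2 * t * (1 - t) * enorm (y - z) ^+ 2.
Proof.
move=> dF [L0 lipF] segD t01.
pose p s : 'rV[R]_m * 'rV[R]_n := (x, z + s *: (y - z)).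
have pE s : p s = (x, s *: y + (1 - s) *: z).
  by rewrite /p scalerBr scalerBl scale1r addrCA addrA addrAC.
have pB a b : p b - p a = (0, (b - a) *: (y - z)).
  rewrite [LHS]surjective_pairing /=; congr pair; first exact: subrr.
  by rewrite opprD addrACA subrr add0r scalerBl.
have := @weakly_convex_segment R (L * enorm (y - z) ^+ 2) (F \o p)
  (fun s => \sum_(j < n) (grad F (p s)).2 0 j * (y - z) 0 j) _ _ t t01.
rewrite /= !pE !(scale1r, scale0r, subrr, subr0, addr0, add0r) => H.
apply: le_trans (H _ _) _ => [s|a b a0 ab b1|]; last by lra.
- exact/is_derive_line/dF.
- rewrite -sumrB.
  under eq_bigr do rewrite -mulrBl.
  have -> : \sum_(i < n) ((grad F (p a)).2 0 i - (grad F (p b)).2 0 i) *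
      (y - z) 0 i
    = \sum_(i < n) (grad F (p a) - grad F (p b)).2 0 i * (y - z) 0 i.
    by apply: eq_bigr => i _; rewrite !mxE.
  apply: le_trans (sum_cauchy_schwarz (grad F (p a) - grad F (p b)).2 (y - z)) _.
  have -> : L * enorm (y - z) ^+ 2 * (b - a)
      = L * enorm2 (p b - p a) * enorm (y - z).
    rewrite pB enorm2_0l enormZ ger0_norm ?subr_ge0//; ring.
  apply: ler_wpM2r; first exact: enorm_ge0.
  apply: (le_trans (enorm_snd_le (grad F (p a) - grad F (p b)))).
  have -> : enorm2 (p b - p a) = enorm2 (p a - p b).
    by rewrite !pB !enorm2_0l !enormZ distrC.
  by apply: lipF; rewrite pE; apply: segD; lra.
Qed.

End grad_lipschitz.

(** * Minimizing a strongly convex function *)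

Lemma convex_set_segment (R : realType) (n : nat) (D : set 'rV[R]_n) (t : R)
    (y z : 'rV[R]_n) :
  convex_set D -> 0 <= t <= 1 -> D y -> D z -> D (t *: y + (1 - t) *: z).
Proof.
move=> cD t01 Dy Dz.
case/andP: t01 => t0 t1.
have := cD y z (Itv01 t0 t1) (mem_set Dy) (mem_set Dz).
by rewrite inE.
Qed.

Lemma strongly_convexD_weakly (R : realType) (n : nat) (mu rho c : R)
    (D : set 'rV[R]_n) (F G : 'rV[R]_n -> R) :
  0 <= c -> strongly_convex mu D G ->
  (forall (t : R) y z, 0 <= t <= 1 -> D y -> D z ->
    F (t *: y + (1 - t) *: z) <= t * F y + (1 - t) * F z
      + rho / 2 * t * (1 - t) * enorm (y - z) ^+ 2) ->
  strongly_convex (mu - c * rho) D (fun y => c * F y + G y).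
Proof.
move=> c0 scG wcF t y z t01 Dy Dz.
have := ler_wpM2l c0 (wcF t y z t01 Dy Dz).
have := scG t y z t01 Dy Dz.
lra.
Qed.

Section strongly_convex_minimization.
Context (R : realType) (n : nat).
Variables (mu : R) (D : set 'rV[R]_n) (F : 'rV[R]_n -> R).
Hypotheses (mu_gt0 : 0 < mu) (D_convex : convex_set D).
Hypothesis (F_sc : strongly_convex mu D F).

(** Since F y0 <= F (t y + (1 - t) y0), strong convexity gives
mu/2 (1 - t) |y - y0|^2 <= F y - F y0 for every t in ]0, 1]; then t tends to 0. *)
Lemma strongly_convex_growth (y0 y : 'rV[R]_n) :
  D y0 -> (forall z, D z -> F y0 <= F z) -> D y ->
  F y0 + mu / 2 * enorm (y - y0) ^+ 2 <= F y.
Proof.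
move=> Dy0 y0min Dy; set r2 := enorm _ ^+ 2.
have key (t : R) : 0 < t -> t <= 1 -> mu / 2 * (1 - t) * r2 <= F y - F y0.
  move=> t0 t1; have t01 : 0 <= t <= 1 by rewrite (ltW t0).
  have := F_sc t01 Dy Dy0; rewrite -/r2.
  have := y0min _ (convex_set_segment D_convex t01 Dy Dy0) => /le_trans/[apply] H.
  rewrite -(ler_pM2l t0); lra.
rewrite -lerBrDl; apply/ler_addgt0Pr => e e0.
(* The loss t M, where M = mu/2 |y - y0|^2, must stay below e; t = e / (M + e)
   achieves this and lies in ]0, 1]. *)
pose M := mu / 2 * r2.
have M0 : 0 <= M by rewrite mulr_ge0 ?sqr_ge0 ?divr_ge0 ?(ltW mu_gt0).
have Me : 0 < M + e by lra.
have te : e / (M + e) * (M + e) = e by rewrite divfK// gt_eqF.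
have t0 : 0 < e / (M + e) by rewrite divr_gt0.
have t1 : e / (M + e) <= 1 by rewrite ler_pdivrMr//; lra.
have := key _ t0 t1; move: te t0 t1; set t := e / _ => te t0 t1.
have te0 : 0 <= t * e by rewrite mulr_ge0 ?ltW.
rewrite -/M mulrAC -/M => Mt.
lra.
Qed.

(** Coercivity. A point y at distance N > 1 from y0 is pulled back to the unit
ball at parameter t = 1/N; there F is at least c, while strong convexity
lowers the chord by mu/2 (N - 1), which must then be at most F y0 - c. The unit
ball is that of the sup norm, the one whose closed balls the compactness
argument below uses. *)
Lemma strongly_convex_sublevel_bounded (y0 y : 'rV[R]_n) (c : R) :
  D y0 -> (forall z, D z -> `|z - y0| <= 1 -> c <= F z) ->
  D y -> F y <= F y0 ->
  enorm (y - y0) <= 1 + 2 * (F y0 - c) / mu.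
Proof.
move=> Dy0 cmin Dy Fy.
have c_le : c <= F y0 by apply: cmin; rewrite // subrr normr0.
have [N1|N1] := leP (enorm (y - y0)) 1.
  apply: (le_trans N1); rewrite lerDl divr_ge0 ?(ltW mu_gt0)//.
  by rewrite mulr_ge0 ?subr_ge0.
set N := enorm _ in N1 *.
have N0 : 0 < N by lra.
have t01 : 0 <= N^-1 <= 1 by rewrite invr_ge0 (ltW N0)/= invf_le1// ltW.
have /cmin := convex_set_segment D_convex t01 Dy Dy0.
have -> : N^-1 *: y + (1 - N^-1) *: y0 - y0 = N^-1 *: (y - y0).
  by rewrite scalerBl scale1r scalerBr [y0 - _]addrC addrA addrK.
move=> /(_ _)/le_trans H.
have {}H := H _ _ (F_sc t01 Dy Dy0).
have : c <= N^-1 * F y + (1 - N^-1) * F y0 - mu / 2 * N^-1 * (1 - N^-1) * N ^+ 2.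
  apply: H; rewrite (le_trans (mx_norm_le_enorm _))// enormZ.
  by rewrite ger0_norm ?mulVf ?gt_eqF// invr_ge0 ltW.
have -> : mu / 2 * N^-1 * (1 - N^-1) * N ^+ 2 = mu / 2 * (N - 1).
  by field; rewrite gt_eqF.
move=> {}H.
rewrite -lerBlDl ler_pdivlMr//.
have : N^-1 * (F y - F y0) <= 0 by rewrite pmulr_rle0 ?invr_gt0// subr_le0.
lra.
Qed.

Hypotheses (D_ne : D !=set0) (D_closed : closed D) (F_cont : continuous F).

Lemma min_on_ball (y0 : 'rV[R]_n) (r : R) : D y0 -> 0 < r ->
  exists2 c, D c & forall z, D z -> `|z - y0| <= r -> F c <= F z.
Proof.
move=> Dy0 r0; pose K := D `&` closed_ball y0 r.
have Ky0 : K y0 by split => //; exact: closed_ballxx.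
have clK : closed K by apply: closedI => //; exact: closed_ball_closed.
have bK : bounded_set K.
  exists (`|y0| + r); split; first exact: num_real.
  move=> M MM z [_]; rewrite closed_ballE// /closed_ball_ /= => zr.
  rewrite (le_trans _ (ltW MM))// -[z in leLHS](subrKC y0).
  by rewrite (le_trans (ler_normD _ _))// lerD2l distrC.
have [c] := EVT_min_rV (ex_intro _ _ Ky0) (bounded_closed_compact bK clK)
  (continuous_subspaceT F_cont).
rewrite inE => -[Dc _] cmin; exists c => // z Dz zr.
apply: cmin; rewrite inE; split=> //.
by rewrite closed_ballE// /closed_ball_ /= distrC.
Qed.

(** The extreme value theorem is used twice: on the unit ball, to get the lower
bound that confines the sublevel set of F y0, and then on a ball containing this
sublevel set. *)
Lemma strongly_convex_min_exists :
  exists2 y, D y & forall z, D z -> F y <= F z.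
Proof.
have [y0 Dy0] := D_ne.
have [c0 _ c0min] := min_on_ball Dy0 ltr01.
have b_gt0 : 0 < 1 + 2 * (F y0 - F c0) / mu.
  rewrite ltr_wpDr// divr_ge0 ?mulr_ge0 ?subr_ge0 ?(ltW mu_gt0)//.
  by apply: c0min; rewrite // subrr normr0.
have [c Dc cmin] := min_on_ball Dy0 b_gt0.
exists c => // z Dz.
have [Fz|/ltW Fz] := leP (F z) (F y0).
  apply: cmin => //; apply: (le_trans (mx_norm_le_enorm _)).
  exact: strongly_convex_sublevel_bounded.
by apply: le_trans Fz; apply: cmin; rewrite // subrr normr0 ltW.
Qed.

End strongly_convex_minimization.

(** * Values of attained optima *)

Lemma argmin_spec (R : realType) (n : nat) (D : set 'rV[R]_n)
    (F : 'rV[R]_n -> R) :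
  (exists2 y, D y & forall z, D z -> F y <= F z) ->
  D (argmin D F) /\ forall z, D z -> F (argmin D F) <= F z.
Proof.
case=> y Dy ymin.
exact: (@xgetI _ 0 [set y | D y /\ forall z, D z -> F y <= F z] y).
Qed.

Lemma min_onE (R : realType) (n : nat) (D : set 'rV[R]_n)
    (F : 'rV[R]_n -> R) (y : 'rV[R]_n) :
  D y -> (forall z, D z -> F y <= F z) -> min_on D F = F y.
Proof.
move=> Dy ymin; have [Da amin] : D (argmin D F) /\
    forall z, D z -> F (argmin D F) <= F z.
  by apply: argmin_spec; exists y.
by apply/eqP; rewrite eq_le amin//= ymin.
Qed.

Lemma max_onE (R : realType) (n : nat) (D : set 'rV[R]_n)
    (F : 'rV[R]_n -> R) (y : 'rV[R]_n) :
  D y -> (forall z, D z -> F z <= F y) -> max_on D F = F y.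
Proof.
move=> Dy ymax; have [Da amax] : D (argmax D F) /\
    forall z, D z -> F z <= F (argmax D F).
  exact: (@xgetI _ 0 [set y | D y /\ forall z, D z -> F z <= F y] y).
by apply/eqP; rewrite eq_le ymax//= amax.
Qed.

(** * The penalty bound *)

Lemma continuous_pairr (R : realType) (m n : nat)
    (F : 'rV[R]_m * 'rV[R]_n -> R) (x : 'rV[R]_m) :
  continuous F -> continuous (fun y => F (x, y)).
Proof.
move=> cF y.
apply: (@continuous_comp _ _ _ (fun y : 'rV[R]_n => (x, y)) F); last exact: cF.
by apply: (@cvg_pair _ _ _ (nbhs y) (nbhs x) (nbhs y)) => /=;
  [exact: cvg_cst|exact: cvg_id].
Qed.

Unset Implicit Arguments.
Set Strict Implicit.

Theorem theorem4p1 (R : realType) (dx dy dh : nat)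
    (f g : 'rV[R]_dx * 'rV[R]_dy -> R)
    (h : 'rV[R]_dx * 'rV[R]_dy -> 'rV[R]_dh)
    (lf0 lf1 lg1 mu_g delta : R)
    (C1f : C1 f) (C1g : C1 g)
    (feasible_ne : forall x, feasible h x !=set0)
    (feasible_closed : forall x, closed (feasible h x))
    (feasible_convex : forall x, convex_set (feasible h x))
    (Phi_bounded_below :
      (-oo < ereal_inf (range (fun x => (Phi f g h x)%:E)))%E)
    (lip_f : lipschitz_with (@Num.norm R R) lf0 (feasible_graph h) f)
    (lip_grad_f : lipschitz_with (@enorm2 R dx dy) lf1 (feasible_graph h) (grad f))
    (lip_grad_g : lipschitz_with (@enorm2 R dx dy) lg1 (feasible_graph h) (grad g))
    (mu_g_gt0 : 0 < mu_g)
    (g_strongly_convex : forall x,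
      strongly_convex mu_g (feasible h x) (fun y => g (x, y)))
    (delta_gt0 : 0 < delta)
    (* when lf1 = 0 the bound mu_g / (2 * lf1) is +oo *)
    (delta_le : 0 < lf1 -> delta <= mu_g / (2 * lf1)) :
  forall x : 'rV[R]_dx,
    0 <= Phi f g h x - Phi_pen f g h delta x <= delta * lf0 ^+ 2 / (2 * mu_g) /\
    enorm (ystar_pen f g h delta x - ystar g h x) <= 2 * delta * lf0 / mu_g.
Proof.
move=> x; set Y := feasible h x.
pose F y := f (x, y); pose G y := g (x, y); pose P y := delta * F y + G y.
have [lf0_ge0 lipF] := lip_f; have [lf1_ge0 _] := lip_grad_f.
have F_cont : continuous F.
  by apply: continuous_pairr => p; exact/differentiable_continuous/(proj1 C1f).
have G_cont : continuous G.
  by apply: continuous_pairr => p; exact/differentiable_continuous/(proj1 C1g).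
have P_cont : continuous P.
  move=> y; apply: (@continuousD _ _ _ (delta \*o F) G); last exact: G_cont.
  by apply: continuousM; [exact: cst_continuous|exact: F_cont].
(* When lf1 = 0 the left-hand side vanishes. *)
have dlf1 : delta * lf1 <= mu_g / 2.
  have [lf1_gt0|] := ltP 0 lf1.
    have := delta_le lf1_gt0.
    by rewrite ler_pdivlMr ?mulr_gt0//; lra.
  nra.
set nu := mu_g - delta * lf1.
have nu_gt0 : 0 < nu by rewrite /nu; lra.
have P_sc : strongly_convex nu Y P.
  apply: strongly_convexD_weakly (ltW delta_gt0) (g_strongly_convex x) _.
  move=> t y z t01 Yy Yz; apply: grad_lipschitz_weakly_convex lip_grad_f _ t01.
    by case: C1f.
  by move=> s s01; exact: (convex_set_segment (feasible_convex x)).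
have [Ya Ga] := argmin_spec (strongly_convex_min_exists mu_g_gt0
  (feasible_convex x) (g_strongly_convex x) (feasible_ne x)
  (feasible_closed x) G_cont).
have [Yb Pb] := argmin_spec (strongly_convex_min_exists nu_gt0
  (feasible_convex x) P_sc (feasible_ne x) (feasible_closed x) P_cont).
rewrite -/(ystar g h x) in Ya Ga.
rewrite -/(ystar_pen f g h delta x) in Yb Pb.
set a := ystar g h x in Ya Ga *; set b := ystar_pen f g h delta x in Yb Pb *.
(* An attained optimum has the same value at every optimizer, so those chosen
   inside the penalty function may be replaced by a and b. *)
have PhiE : Phi_pen f g h delta x = delta^-1 * (P b - G a).
  rewrite /Phi_pen; set pen := (fun y => max_on _ _).
  have penE y : pen y = delta^-1 * (P y - G a).
    rewrite /pen (max_onE (y := a))//.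
      by rewrite /P /F /G; field; rewrite gt_eqF.
    by move=> z Yz; rewrite lerD2l ler_pM2l ?invr_gt0// lerD2l lerN2 Ga.
  rewrite (min_onE (y := b)) ?penE// => z Yz.
  by rewrite !penE ler_pM2l ?invr_gt0// lerD2r Pb.
have Gba := strongly_convex_growth mu_g_gt0
  (feasible_convex x) (g_strongly_convex x) Ya Ga Yb.
have Pab := strongly_convex_growth nu_gt0
  (feasible_convex x) P_sc Yb Pb Ya.
have Fab : F a - F b <= lf0 * enorm (b - a).
  apply: (le_trans (ler_norm _)).
  have := lipF (x, a) (x, b) Ya Yb.
  have -> : (x, a) - (x, b) = (0, a - b).
    by rewrite [LHS]surjective_pairing /=; congr pair; exact: subrr.
  by rewrite enorm2_0l -enormN opprB.
have Pba := Pb a Ya.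
rewrite -enormN opprB in Pab.
rewrite PhiE -/(F a) /Phi -/a -/(F a).
have r_ge0 := enorm_ge0 (b - a).
set r := enorm (b - a) in Gba Pab Fab r_ge0 *.
have gapE : F a - delta^-1 * (P b - G a) = delta^-1 * (P a - P b).
  by rewrite /P; field; rewrite gt_eqF.
have dFab : delta * (F a - F b) <= delta * (lf0 * r) by rewrite ler_pM2l.
have gap_le : P a - P b <= delta * (lf0 * r) - mu_g / 2 * r ^+ 2.
  have -> : P a - P b = delta * (F a - F b) + (G a - G b) by rewrite /P; ring.
  by move: Gba dFab; rewrite -/(G a) -/(G b); lra.
rewrite gapE; split; [apply/andP; split|].
- by rewrite mulr_ge0 ?subr_ge0 ?invr_ge0 ?(ltW delta_gt0).
- rewrite ler_pdivrMl// mulrA ler_pdivlMr ?mulr_gt0//.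
  have mu2_ge0 : 0 <= 2 * mu_g by lra.
  have := ler_wpM2r mu2_ge0 gap_le.
  (* Completing the square maximizes delta lf0 r - mu_g/2 r^2 over r. *)
  have := sqr_ge0 (delta * lf0 - mu_g * r).
  lra.
- rewrite ler_pdivlMr//.
  have [->|r_neq0] := eqVneq r 0.
    by rewrite mul0r !mulr_ge0// ltW.
  have r_gt0 : 0 < r by rewrite lt_def r_neq0.
  (* As nu >= mu_g / 2, the growth of P at b is at least mu_g / 4 r^2; with gap_le
     this gives 3/4 mu_g r^2 <= delta lf0 r, and r is cancelled. *)
  have nur : mu_g / 2 / 2 * r ^+ 2 <= nu / 2 * r ^+ 2.
    by apply: ler_wpM2r; [exact: sqr_ge0|rewrite /nu; lra].
  have mur : 0 <= mu_g * r ^+ 2 by rewrite mulr_ge0 ?sqr_ge0// ltW.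
  rewrite -(ler_pM2l r_gt0).
  by move: gap_le Pab; rewrite -/(P a) -/(P b); lra.
Qed.
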